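(* Let $\alpha\in(0,1)$, $b,T>0$, $u_0\ge 0$ on $(0,b)$, and let $h\in W^{1,\infty}(0,T)$ be non-negative. Let $s\in C^{0,1}([0,T])$ with $s(0)=b$ and $0\le\dot s\le M$ a.e. on $[0,T]$ for some $M>0$, and let $Q_{s,T}=\{(x,t):0<x<s(t),\,0<t<T\}$. Let $u\in C(\overline{Q_{s,T}})$ with $u_t,\frac{\partial}{\partial x}D_x^\alpha u\in C(Q_{s,T})$ satisfy, in the classical sense, $$\begin{array}{ll} u_t(x,t)=\frac{\partial}{\partial x}D_x^\alpha u(x,t), & 0<x<s(t),\ 0<t<T,\\ -D_x^\alpha u(0^+,t)=h(t), & 0<t<T,\\ u(s(t),t)=0, & 0<t<T,\\ u(x,0)=u_0(x), & 0<x<b,\end{array}$$ and suppose that $u_t$ is integrable on $Q_{s,T}$. Then the fractional Stefan condition $$\dot s(t)=-D_x^\alpha u(s(t),t)\qquad (0<t<T)$$ (understood for almost every $t$) is equivalent to the integral condition $$s(t)=b+\int_0^t h(\tau)\,d\tau+\int_0^b u_0(x)\,dx-\int_0^{s(t)}u(x,t)\,dx,\qquad 0<t<T .$$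
   Context: For $\alpha\in(0,1)$ the Caputo derivative in $x$ with base point $0$ is $D_x^{\alpha}u(x,t)=\frac{1}{\Gamma(1-\alpha)}\int_0^x (x-p)^{-\alpha}u_x(p,t)\,dp$, understood for $u(\cdot,t)$ absolutely continuous. $D_x^\alpha u(0^+,t)=\lim_{x\to0^+}D_x^\alpha u(x,t)$, and $D_x^\alpha u(s(t),t)$ means $\lim_{x\to s(t)^-}D_x^\alpha u(x,t)$. *)

(* Defs.v *)
From HB Require Import structures.
From mathcomp Require Import all_boot all_order all_algebra.
From mathcomp Require Import all_classical all_reals all_analysis.

Set Implicit Arguments.
Unset Strict Implicit.
Unset Printing Implicit Defensive.

Import Order.TTheory GRing.Theory Num.Theory.
Import numFieldNormedType.Exports.

Local Open Scope classical_set_scope.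
Local Open Scope ring_scope.

Local Notation mu := (@lebesgue_measure _).

Section Caputo.
Context {R : realType}.

(* Degenerate intervals l i = r i are allowed; they contribute 0 to both sums. *)
Definition absolutely_continuous_on (a b : R) (f : R -> R) : Prop :=
  forall e : R, 0 < e -> exists2 d : R, 0 < d &
    forall (n : nat) (l r : 'I_n -> R),
      (forall i, [/\ a <= l i, l i <= r i & r i <= b]) ->
      trivIset [set: 'I_n] (fun i => `]l i, r i[%classic) ->
      \sum_(i < n) (r i - l i) < d ->
      \sum_(i < n) `|f (r i) - f (l i)| < e.

Definition Gamma (z : R) : R :=
  \int[mu]_(t in `]0, +oo[) (t `^ (z - 1) * expR (- t)).

Definition caputo_integrand (alpha : R) (f : R -> R) (x p : R) : R :=
  (x - p) `^ (- alpha) * derive1 f p.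

(* The real-valued integral is 0 by convention when it diverges, so the formula
   is meaningful only when the integrand is integrable. *)
Definition caputo (alpha : R) (f : R -> R) (x : R) : R :=
  (Gamma (1 - alpha))^-1 * \int[mu]_(p in `]0, x[) caputo_integrand alpha f x p.

Definition caputo_defined (alpha : R) (f : R -> R) (x : R) : Prop :=
  mu.-integrable `]0, x[%classic (EFin \o caputo_integrand alpha f x).

End Caputo.

Section Sobolev.
Context {R : realType}.

Definition Linfty (a b : R) (f : R -> R) : Prop :=
  f \_ `]a, b[%classic \in Lfun mu (+oo%E : \bar R).

Definition test_function (a b : R) (phi : R -> R) : Prop :=
  (forall (n : nat) (x : R), derivable (derive1n n phi) x 1) /\
  (exists K : set R, [/\ compact K, K `<=` `]a, b[%classic
                       & forall x, ~ K x -> phi x = 0]).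

Definition weak_derivative (a b : R) (f g : R -> R) : Prop :=
  forall phi : R -> R, test_function a b phi ->
    \int[mu]_(x in `]a, b[) (f x * derive1 phi x) =
    - \int[mu]_(x in `]a, b[) (g x * phi x).

Definition W1infty (a b : R) (f : R -> R) : Prop :=
  Linfty a b f /\ exists g : R -> R, Linfty a b g /\ weak_derivative a b f g.

End Sobolev.

Section Stefan.
Context {R : realType}.

Definition Qdom (s : R -> R) (T : R) : set (R * R) :=
  [set z | 0 < z.1 < s z.2 /\ 0 < z.2 < T].

(* u is a function of the pair (x, t). *)
Definition time_deriv (u : R * R -> R) (z : R * R) : R :=
  derive1 (fun t => u (z.1, t)) z.2.

Definition Dx (alpha : R) (u : R * R -> R) (x t : R) : R :=
  caputo alpha (fun y => u (y, t)) x.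

Definition Dx_flux (alpha : R) (u : R * R -> R) (z : R * R) : R :=
  derive1 (fun x => Dx alpha u x z.2) z.1.

(* Membership of a derivative in C(Q) includes its existence at every point of
   Q; likewise the Caputo derivative has to make sense at every point of Q. *)
Record classical_solution (alpha b T : R) (h u0 s : R -> R)
    (u : R * R -> R) : Prop := ClassicalSolution {
  cs_cont : {within closure (Qdom s T), continuous u};
  cs_ac : forall t, 0 < t < T ->
    absolutely_continuous_on 0 (s t) (fun x => u (x, t));
  cs_caputo : forall x t, Qdom s T (x, t) ->
    caputo_defined alpha (fun y => u (y, t)) x;
  cs_ut : forall x t, Qdom s T (x, t) -> derivable (fun t' => u (x, t')) t 1;
  cs_ut_cont : {within Qdom s T, continuous (time_deriv u)};
  cs_flux : forall x t, Qdom s T (x, t) ->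
    derivable (fun x' => Dx alpha u x' t) x 1;
  cs_flux_cont : {within Qdom s T, continuous (Dx_flux alpha u)};
  cs_eq : forall z, Qdom s T z -> time_deriv u z = Dx_flux alpha u z;
  cs_left : forall t, 0 < t < T -> - Dx alpha u x t @[x --> 0^'+] --> h t;
  cs_right : forall t, 0 < t < T -> u (s t, t) = 0;
  cs_init : forall x, 0 < x < b -> u (x, 0) = u0 x
}.

Definition fractional_Stefan_condition (alpha T : R) (s : R -> R)
    (u : R * R -> R) : Prop :=
  {ae mu, forall t : R, 0 < t < T ->
     derivable s t 1 /\ - Dx alpha u x t @[x --> (s t)^'-] --> derive1 s t}.

Definition integral_condition (b T : R) (h u0 s : R -> R)
    (u : R * R -> R) : Prop :=
  forall t : R, 0 < t < T ->
    s t = b + \int[mu]_(tau in `]0, t[) h tau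
            + \int[mu]_(x in `]0, b[) u0 x
            - \int[mu]_(x in `]0, s t[) u (x, t).

End Stefan.

(* Main.v *)
Require Import Defs.
From HB Require Import structures.
From mathcomp Require Import all_boot all_order all_algebra.
From mathcomp Require Import all_classical all_reals all_analysis.
From mathcomp Require Import measurable_realfun ess_sup_inf lra.
Set Implicit Arguments.
Unset Strict Implicit.
Unset Printing Implicit Defensive.

Import Order.TTheory GRing.Theory Num.Theory.
Import numFieldNormedType.Exports.
Local Open Scope classical_set_scope.
Local Open Scope ring_scope.

Local Notation mu := (@lebesgue_measure _).

(** Write [W t] for the integral of [u_t] over the slice [0 < x < s t].  The
proof reduces both conditions to a statement about the single function
[v = h - W], which is integrable on [0 < t < T] by Fubini's theorem.

The equation says that [u_t] is the [x]-derivative of [Dx u].  On almost every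
time slice [u_t] is integrable, so it can be integrated from [x = 0], where
[Dx u] tends to [- h t], up to the front: [- Dx u] tends to
[h t - W t = v t] there ([flux_at_front]).  Hence the Stefan condition says
exactly that [s' = v] almost everywhere.

Integrating [u_t] over the part of the domain before time [t] in the other
order gives the heat balance ([heat_balance]): along a vertical line the
integral of [u_t] is [u (x, t)] minus the value of [u] at the time when the line
enters the domain.  That value is [u0 x] if [x < b], and [0] if [x > b] because
the line then enters through the front.  So the heat content at time [t] minus
the initial heat content is the integral of [W] over [0 < y < t], and the
integral condition says exactly that [s t = b + \int_0^t v] for all [t].

Finally, for a Lipschitz [s], having [s' = v] almost everywhere is the same as
having [s t = s 0 + \int_0^t v] ([derive_ae_eqP]).  One direction is Lebesgue's
differentiation theorem.  The other, [lipschitz_FTC], follows from dominated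
convergence applied to the difference quotients of [s], which the Lipschitz
constant bounds uniformly.  The same argument shows that [s], whose derivative
is nonnegative almost everywhere, is nondecreasing
([lipschitz_derive_ge0_le]); this is what makes every vertical section of the
domain an interval ending at time [t] ([xsection_Qdom]).  *)

(** * Integration by primitives up to the endpoints of an interval *)

Lemma lebesgue_integrableS {R : realType} (A B : set R) (f : R -> \bar R) :
  measurable A -> measurable B -> B `<=` A ->
  mu.-integrable A f -> mu.-integrable B f.
Proof. by move=> mA mB BA iA; apply: integrableS iA. Qed.

Lemma integrable_itv_oo_cc {R : realType} (a b : R) (f : R -> R) :
  mu.-integrable `]a, b[ (EFin \o f) ->
  mu.-integrable `[a, b] (EFin \o f).
Proof.
move=> /integrableP[mf foo]; apply/integrableP; split.
  by apply/emeasurable_fun_itv_bndo_bndcP/emeasurable_fun_itv_obnd_cbndP.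
have mabs : measurable_fun `]a, b[ (abse \o (EFin \o f)).
  exact: measurableT_comp.
rewrite -integral_itv_bndo_bndc; last exact/emeasurable_fun_itv_obnd_cbndP.
by rewrite -integral_itv_obnd_cbnd.
Qed.

Lemma Rintegral_itv_oo_cc {R : realType} (a b : R) (f : R -> R) :
  mu.-integrable `]a, b[ (EFin \o f) ->
  \int[mu]_(x in `]a, b[) f x = \int[mu]_(x in `[a, b]) f x.
Proof.
move=> intf; have icc := integrable_itv_oo_cc intf.
rewrite Rintegral_itv_obnd_cbnd// Rintegral_itv_bndo_bndc//.
apply: integrableS icc => //; by apply: subset_itvl; rewrite bnd_simp.
Qed.

Lemma eq_derive_cst_itv {R : realType} (a b : R) (F G : R -> R) :
  (forall x, a < x < b -> derivable F x 1) ->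
  (forall x, a < x < b -> derivable G x 1) ->
  (forall x, a < x < b -> derive1 F x = derive1 G x) ->
  forall x y, a < x < b -> a < y < b -> F x - G x = F y - G y.
Proof.
move=> dF dG FG.
pose D : R -> R := F - G.
have dD x : x \in `]a, b[ -> derivable D x 1.
  by rewrite in_itv/= => xab; apply: derivableB; [exact: dF|exact: dG].
have D0 x : x \in `]a, b[ -> derive1 D x = 0.
  rewrite in_itv/= => xab; rewrite derive1E deriveB; [|exact: dF|exact: dG].
  by rewrite -!derive1E FG// subrr.
have cD : {in `]a, b[%classic, continuous D}.
  move=> x; rewrite inE => xab.
  exact/differentiable_continuous/derivable1_diffP/dD.
suff H x y : a < x < b -> a < y < b -> x <= y -> D x = D y.
  move=> x y xab yab; case: (leP x y) => [xy|/ltW yx].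
    exact: (H x y).
  by apply/esym; exact: (H y x).
move=> xab yab xy; apply/eqP; rewrite eq_le; apply/andP; split.
- by apply: (ger0_derive1_le_oo dD _ cD) => //; move=> z /D0 ->.
- by apply: (ler0_derive1_le_oo dD _ cD) => //; move=> z /D0 ->.
Qed.

(** Neither [f] nor [F] is controlled at the endpoints beyond integrability of
[f] and the limit of [F] at [a].  In the interior [F] and the indefinite
integral of [f] have the same derivative, so they differ by a constant, which
is identified at [a]; at [b] it is continuity of the indefinite integral that
provides the limit.  *)
Lemma improper_FTC {R : realType} (a b l : R) (f F : R -> R) : a < b ->
  mu.-integrable `]a, b[ (EFin \o f) ->
  (forall x, a < x < b -> {for x, continuous f}) ->
  (forall x, a < x < b -> derivable F x 1) ->
  (forall x, a < x < b -> derive1 F x = f x) ->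
  F x @[x --> a^'+] --> l ->
  F x @[x --> b^'-] --> l + \int[mu]_(x in `]a, b[) f x.
Proof.
move=> ab intf cf dF F'f Fl.
have intfc := integrable_itv_oo_cc intf.
pose P x := \int[mu]_(t in [set` `[a, x]]) f t.
have dP x : a < x < b -> derivable P x 1 /\ derive1 P x = f x.
  move=> /andP[ax xb].
  apply: (@continuous_FTC1_closed _ f a x b xb intfc) => //.
  by apply: cf; rewrite ax.
have /continuous_within_itvP-/(_ ab)[_ Pa Pb] :=
  parameterized_integral_continuous (ltW ab) intfc.
have Pa0 : P a = 0 by rewrite /P set_itv1 Rintegral_set1.
have FP := eq_derive_cst_itv (fun x h => dF x h) (fun x h => (dP x h).1)
  (fun x h => etrans (F'f x h) (esym (dP x h).2)).
have FPl x : a < x < b -> F x - P x = l.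
  move=> xab.
  apply: (@cvg_unique _ (@norm_hausdorff _ R) (F y - P y @[y --> a^'+])) => //.
    apply: cvg_near_cst; near=> y; apply: FP => //.
    by apply/andP; split; near: y; [exact: nbhs_right_gt|exact: nbhs_right_lt].
  by rewrite -[l]subr0 -Pa0; exact: cvgB.
rewrite Rintegral_itv_oo_cc//.
have : l + P y @[y --> b^'-] --> l + P b by apply: cvgD => //; exact: cvg_cst.
apply: cvg_trans; apply: near_eq_cvg; near=> y.
rewrite -(FPl y) ?subrK//.
by apply/andP; split; near: y; [exact: nbhs_left_gt|exact: nbhs_left_lt].
Unshelve. all: by end_near. Qed.

(** * Lipschitz functions are recovered from their derivative *)

Lemma ae_imp {R : realType} (P Q : R -> Prop) :
  (forall x, P x -> Q x) -> {ae mu, forall x, P x} ->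
  {ae mu, forall x, Q x}.
Proof.
move=> PQ; apply: filterS; first exact: (ae_filter_ringOfSetsType mu).
exact: PQ.
Qed.

Lemma ae_and {R : realType} (P Q : R -> Prop) :
  {ae mu, forall x, P x} ->
  {ae mu, forall x, Q x} ->
  {ae mu, forall x, P x /\ Q x}.
Proof.
apply: filterI; exact: (ae_filter_ringOfSetsType mu).
Qed.

Definition fwd_diff_quot {R : realType} (f : R -> R) (n : nat) (x : R) : R :=
  n.+1%:R * (f (x + n.+1%:R^-1) - f x).

Lemma fwd_diff_quot_cvg {R : realType} (f : R -> R) (x : R) :
  derivable f x 1 -> fwd_diff_quot f n x @[n --> \oo] --> derive1 f x.
Proof.
move=> df; rewrite derive1E.
have h0 : (@harmonic R) n @[n --> \oo] --> 0^'.
  move=> A [e /= e0 eA].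
  have [N _ NH] := @cvg_harmonic R _ (nbhsx_ballx 0 e e0).
  exists N => // n /NH /= nb; apply: eA => //=.
rewrite (_ : fwd_diff_quot f ^~ x =
  (fun h => h^-1 *: ((f \o shift x) h%:A - f x)) \o harmonic).
  exact: cvg_comp h0 df.
apply/funext => n.
by rewrite /fwd_diff_quot/= invrK /GRing.scale/= mulr1 [x + _]addrC.
Qed.

Lemma measurable_fwd_diff_quot {R : realType} (f : R -> R) n (D : set R) :
  continuous f -> measurable_fun D (fwd_diff_quot f n).
Proof.
move=> cf; apply: measurable_funTS; apply: continuous_measurable_fun => x.
apply: cvgMr; apply: cvgB; last exact: cf.
apply: (@cvg_comp _ _ _ (fun y => y + n.+1%:R^-1) f); last exact: cf.
by apply: cvgD => //; exact: cvg_cst.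
Qed.

(** The difference quotients of [f] are the derivatives of the difference
quotients of a primitive [P] of [f], so their integral over [[a, c]] is the
difference of two difference quotients of [P], which tend to [P' = f].  *)
Lemma integral_fwd_diff_quot_cvg {R : realType} (f : R -> R) (a c : R) :
  continuous f -> a < c ->
  (\int[mu]_(x in `]a, c[) (fwd_diff_quot f n x)%:E)%E @[n --> \oo]
    --> (f c - f a)%:E.
Proof.
move=> cf ac.
pose P x := \int[mu]_(t in [set` `[a - 1, x]]) f t.
have dP x : a - 1 < x < c + 2 -> derivable P x 1 /\ derive1 P x = f x.
  move=> /andP[ax xc].
  apply: (@continuous_FTC1_closed _ f (a - 1) x (c + 2) xc) => //; last first.
    exact: cf.
  apply: continuous_compact_integrable; first exact: segment_compact.
  exact: continuous_subspaceT.
clearbody P.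

have PE n : (\int[mu]_(x in `]a, c[) (fwd_diff_quot f n x)%:E)%E =
            (fwd_diff_quot P n c - fwd_diff_quot P n a)%:E.
  have : (n.+1%:R^-1 : R) <= 1 by rewrite invf_le1// ler1n.
  have : (0 : R) < n.+1%:R^-1 by rewrite invr_gt0.
  have mf D : measurable_fun D (EFin \o fwd_diff_quot f n).
    by apply/measurable_EFinP; exact: measurable_fwd_diff_quot.
  rewrite integral_itv_obnd_cbnd ?integral_itv_bndo_bndc//; try exact: mf.
  rewrite /fwd_diff_quot; move: (n.+1%:R) (n.+1%:R^-1) => k h h0 h1.
  have dPd x : a - 1 < x < c + 2 -> is_derive x 1 P (f x).
    by move=> /dP[d1 d2]; apply: (DeriveDef d1); rewrite -derive1E.
  have dsh x : a - 1 < x < c + 1 ->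
      is_derive x 1 (fun y => P (y + h)) (f (x + h)).
    move=> xac; rewrite -[f _]mulr1.
    apply: (@is_derive1_comp _ P (fun y => y + h)); first by apply: dPd; lra.
    rewrite -[1 in X in is_derive _ _ _ X]addr0.
    exact: is_deriveD (is_derive_id _ _) (is_derive_cst _ _ _).
  have dq x : a - 1 < x < c + 1 ->
      is_derive x 1 (fun y => k * (P (y + h) - P y)) (k * (f (x + h) - f x)).
    move=> xac; apply: is_deriveZ; apply: is_deriveB; first exact: dsh.
    by apply: dPd; lra.
  have cq x : a - 1 < x < c + 1 ->
      {for x, continuous (fun y => k * (P (y + h) - P y))}.
    by move=> /dq[d _]; exact/differentiable_continuous/derivable1_diffP.
  rewrite (@continuous_FTC2 _ _ (fun y => k * (P (y + h) - P y)))//.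
  - apply: continuous_subspaceT => x; apply: cvgMr.
    apply: cvgB; last exact: cf.
    apply: (@cvg_comp _ _ _ (fun y => y + h) f); last exact: cf.
    by apply: cvgD => //; exact: cvg_cst.
  - split.
    + move=> x; rewrite in_itv/= => xac.
      have xac' : a - 1 < x < c + 1 by lra.
      by case: (dq _ xac').
    + by apply: cvg_at_right_filter; apply: cq; lra.
    + by apply: cvg_at_left_filter; apply: cq; lra.
  - move=> x; rewrite in_itv/= => xac.
    have xac' : a - 1 < x < c + 1 by lra.
    by rewrite derive1E; case: (dq _ xac').
under eq_fun do rewrite PE.
apply: cvg_EFin; first by near=> n.
rewrite /comp/=.
have [[da da'] [dc dc']] : (derivable P a 1 /\ derive1 P a = f a) /\
   (derivable P c 1 /\ derive1 P c = f c) by split; apply: dP; lra.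
rewrite -da' -dc'.
apply: cvgB; [exact: fwd_diff_quot_cvg dc|exact: fwd_diff_quot_cvg da].
Unshelve. all: by end_near. Qed.

Lemma lipschitz_continuous {R : realType} (L : R) (f : R -> R) :
  (forall x y, `|f x - f y| <= L * `|x - y|) -> continuous f.
Proof.
move=> lip x; apply/cvgrPdist_lt => e e0.
have L1 : 0 < `|L| + 1 by rewrite ltr_wpDl.
near=> y; apply: le_lt_trans (lip x y) _.
apply: (@le_lt_trans _ _ ((`|L| + 1) * `|x - y|)).
  by rewrite ler_wpM2r// (le_trans (ler_norm L))// lerDl.
rewrite -ltr_pdivlMl// mulrC; near: y.
by apply: (nbhsx_ballx x); rewrite divr_gt0.
Unshelve. all: by end_near. Qed.

Lemma fwd_diff_quot_lipschitz {R : realType} (L : R) (f : R -> R) n x :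
  (forall x y, `|f x - f y| <= L * `|x - y|) -> `|fwd_diff_quot f n x| <= L.
Proof.
move=> lip; rewrite /fwd_diff_quot normrM ger0_norm// mulrC -ler_pdivlMr//.
by apply: le_trans (lip _ _) _; rewrite addrC addKr ger0_norm ?invr_ge0.
Qed.

Lemma integrable_cst_itv {R : realType} (a c L : R) :
  mu.-integrable `]a, c[ (EFin \o cst L).
Proof.
have cc : mu.-integrable `[a, c] (EFin \o cst L).
  apply: continuous_compact_integrable; first exact: segment_compact.
  by apply: continuous_subspaceT => x; exact: cvg_cst.
apply: integrableS cc => //.
by move=> x /=; rewrite !in_itv/= => /andP[/ltW -> /ltW ->].
Qed.

(** The Lipschitz constant dominates all difference quotients, so the limit of
their integrals can be computed under the integral sign.  *)
Lemma lipschitz_FTC {R : realType} (L a c : R) (f v : R -> R) :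
  (forall x y, `|f x - f y| <= L * `|x - y|) -> a < c ->
  measurable_fun `]a, c[ v ->
  {ae mu, forall x, a < x < c ->
     derivable f x 1 /\ derive1 f x = v x} ->
  f c - f a = \int[mu]_(x in `]a, c[) v x.
Proof.
move=> lip ac mv dfv.
have cf := lipschitz_continuous lip.
have [||||||_ _] := @dominated_convergence _ _ _ mu `]a, c[ _
    (fun n x => (fwd_diff_quot f n x)%:E) (EFin \o v) (EFin \o cst L) => //.
- by move=> n; apply/measurable_EFinP; exact: measurable_fwd_diff_quot.
- exact/measurable_EFinP.
- move: dfv; apply: ae_imp => x /= dx; rewrite in_itv/= => /dx[d <-].
  by apply: cvg_EFin; [near=> n|exact: fwd_diff_quot_cvg].
- exact: integrable_cst_itv.
- by apply: aeW => x n _ /=; rewrite lee_fin; exact: fwd_diff_quot_lipschitz.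
move=> Iv; rewrite /Rintegral.
by rewrite (cvg_unique _ Iv (integral_fwd_diff_quot_cvg cf ac)).
Unshelve. all: by end_near. Qed.

(** The increment of [f] is the limit of the integrals of its difference
quotients.  These are bounded below by the integrals of the quotients cut off
above at [0], whose limit is [0] almost everywhere; this avoids passing to the
limit [derive1 f], which need not be measurable.  *)
Lemma lipschitz_derive_ge0_le {R : realType} (L a c : R) (f : R -> R) :
  (forall x y, `|f x - f y| <= L * `|x - y|) -> a < c ->
  {ae mu, forall x, a < x < c ->
     derivable f x 1 /\ 0 <= derive1 f x} ->
  f a <= f c.
Proof.
move=> lip ac df0.
have cf := lipschitz_continuous lip.
have L0 : 0 <= L by apply: le_trans (fwd_diff_quot_lipschitz 0 0 lip).
(* q n is the minimum of the difference quotient and 0 *)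
pose q n x := (fwd_diff_quot f n x - `|fwd_diff_quot f n x|) / 2.
have mq n : measurable_fun (`]a, c[ : set R) (q n).
  apply: measurable_funM => //; apply: measurable_funB.
    exact: measurable_fwd_diff_quot.
  by apply: measurableT_comp => //; exact: measurable_fwd_diff_quot.
have qL n x : `|q n x| <= L.
  have := fwd_diff_quot_lipschitz n x lip; rewrite /q.
  move: (fwd_diff_quot f n x) => y yL; rewrite ler_norml.
  by have := ler_norm y; have := ler_norm (- y); rewrite normrN; lra.
have [||||||_ _] := @dominated_convergence _ _ _ mu `]a, c[ _
    (fun n x => (q n x)%:E) (EFin \o cst 0) (EFin \o cst L) => //.
- by move=> n; apply/measurable_EFinP; exact: mq.
- exact/measurable_EFinP/measurable_cst.
- move: df0; apply: ae_imp => x /= dx; rewrite in_itv/= => /dx[d d0].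
  apply: cvg_EFin; first by near=> n.
  rewrite [X in _ --> X](_ : _ = (derive1 f x - `|derive1 f x|) / 2);
    last first.
    by rewrite ger0_norm// subrr mul0r.
  apply: cvgMl; apply: cvgB; first exact: fwd_diff_quot_cvg.
  by apply: cvg_norm; exact: fwd_diff_quot_cvg.
- exact: integrable_cst_itv.
- by apply: aeW => x n _ /=; rewrite lee_fin.
rewrite integral0_eq// => Iq.
rewrite -subr_ge0 -lee_fin.
apply: (lee_cvg_to Iq (integral_fwd_diff_quot_cvg cf ac)).
have bounded_integrable (g : R -> R) : measurable_fun `]a, c[ g ->
    (forall x, `|g x| <= L) -> mu.-integrable `]a, c[ (EFin \o g).
  move=> mg gL; apply: le_integrable (integrable_cst_itv a c L) => //.
    exact/measurable_EFinP.
  by move=> x _; rewrite /= lee_fin (le_trans (gL x))// ler_norm.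
near=> n; apply: le_integral => //.
- exact: bounded_integrable (mq n) (qL n).
- apply: bounded_integrable; first exact: measurable_fwd_diff_quot.
  by move=> x; exact: fwd_diff_quot_lipschitz.
- move=> x _; rewrite lee_fin /q; move: (fwd_diff_quot f n x) => y.
  by have := ler_norm (- y); rewrite normrN; lra.
Unshelve. all: by end_near. Qed.

(** * Fubini's theorem on a plane domain, slice by slice *)

Lemma ae_eq_Rintegral {R : realType} (f g : R -> R) :
  mu.-integrable setT (EFin \o f) ->
  mu.-integrable setT (EFin \o g) ->
  {ae mu, forall x, f x = g x} ->
  \int[mu]_x f x = \int[mu]_x g x.
Proof.
move=> intf intg fg; rewrite /Rintegral; congr fine.
apply: ae_eq_integral => //.
- exact: (measurable_int mu intf).
- exact: (measurable_int mu intg).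
- by apply: ae_imp fg => x fg _; rewrite /= fg.
Qed.

(** Fubini's theorem for real-valued integrals over the sections of [D]; the
slice integrals are only meaningful almost everywhere, and are [0] by
convention elsewhere.  *)
Section fubini_on_a_domain.
Context {R : realType}.
Variables (D : set (R * R)) (g : R * R -> R).
Hypothesis mD : measurable D.
Hypothesis intg : (mu \x mu)%E.-integrable D (EFin \o g).

Let G : R * R -> \bar R := (EFin \o g) \_ D.

Let intG : (mu \x mu)%E.-integrable setT G.
Proof. exact: (@integrable_mkcond _ _ _ (mu \x mu)%E D (EFin \o g) mD).1. Qed.

Let G_x x : (fun y => G (x, y)) = (fun y => (g (x, y))%:E) \_ (xsection D x).
Proof. by apply/funext => y; rewrite /G /patch mem_xsection. Qed.

Let G_y y : (fun x => G (x, y)) = (fun x => (g (x, y))%:E) \_ (ysection D y).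
Proof. by apply/funext => x; rewrite /G /patch mem_ysection. Qed.

Let mxD x : measurable (xsection D x). Proof. exact: measurable_xsection. Qed.
Let myD y : measurable (ysection D y). Proof. exact: measurable_ysection. Qed.

Lemma ae_integrable_xsection : {ae mu, forall x,
  mu.-integrable (xsection D x) (fun y => (g (x, y))%:E)}.
Proof.
have := ae_integrable1 intG; apply: ae_imp => x.
rewrite G_x.
exact: (@integrable_mkcond _ _ _ mu _ (fun y => (g (x, y))%:E) (mxD x)).2.
Qed.

Lemma ae_integrable_ysection : {ae mu, forall y,
  mu.-integrable (ysection D y) (fun x => (g (x, y))%:E)}.
Proof.
have := ae_integrable2 intG; apply: ae_imp => y.
rewrite G_y.
exact: (@integrable_mkcond _ _ _ mu _ (fun x => (g (x, y))%:E) (myD y)).2.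
Qed.

Let xintE x :
  \int[mu]_(y in xsection D x) g (x, y) = fine (fubini_F mu G x).
Proof. by rewrite /Rintegral integral_mkcond /fubini_F G_x. Qed.

Let yintE y :
  \int[mu]_(x in ysection D y) g (x, y) = fine (fubini_G mu G y).
Proof. by rewrite /Rintegral integral_mkcond /fubini_G G_y. Qed.

Let integrable_fine (k : R -> \bar R) : mu.-integrable setT k ->
  mu.-integrable setT (EFin \o (fine \o k)) /\
  \int[mu]_x (fine (k x)) = fine (\int[mu]_x k x)%E.
Proof.
move=> ik.
have kE : ae_eq mu setT k (EFin \o (fine \o k)).
  have := integrable_ae measurableT ik; apply: ae_imp => x kx _.
  by rewrite /= fineK//; exact: kx.
have mk : measurable_fun setT k by exact: measurable_int ik.
have mfk : measurable_fun setT (EFin \o (fine \o k)).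
  by apply/measurable_EFinP; apply: measurableT_comp.
split; last by rewrite /Rintegral; congr fine; apply/esym/ae_eq_integral.
apply: le_integrable ik => // x _ /=.
by case: (k x) => [r| |] //=; rewrite ?normr0 ?leey.
Qed.

Lemma integrable_xsection_integral : mu.-integrable setT
  (EFin \o (fun x => \int[mu]_(y in xsection D x) g (x, y))).
Proof.
have [+ _] := integrable_fine (integrable_fubini_F intG).
by apply: eq_integrable => // x _; rewrite /= xintE.
Qed.

Let integrable_fubini_G : mu.-integrable setT (fubini_G mu G).
Proof.
have mG : measurable_fun setT G by exact: measurable_int intG.
have mabsG : measurable_fun setT (abse \o G) by exact: measurableT_comp.
apply/integrableP; split; first exact: (measurable_fubini_G intG).
apply: le_lt_trans ((integrable21ltyP mu mu mG).1 intG).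
apply: ge0_le_integral => //.
- by apply: measurableT_comp => //; exact: (measurable_fubini_G intG).
- have := @measurable_fun_fubini_tonelli_G _ _ _ _ R mu (abse \o G) mabsG.
  by apply => z; exact: abse_ge0.
- move=> y _; apply: le_abse_integral => //.
  exact: (measurableT_comp mG).
Qed.

Lemma integrable_ysection_integral : mu.-integrable setT
  (EFin \o (fun y => \int[mu]_(x in ysection D y) g (x, y))).
Proof.
have [+ _] := integrable_fine (integrable_fubini_G).
by apply: eq_integrable => // x _; rewrite /= yintE.
Qed.

Lemma Rintegral_sections :
  \int[mu]_x \int[mu]_(y in xsection D x) g (x, y) =
  \int[mu]_y \int[mu]_(x in ysection D y) g (x, y).
Proof.
under eq_Rintegral do rewrite xintE.
under [RHS]eq_Rintegral do rewrite yintE.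
rewrite (integrable_fine (integrable_fubini_F intG)).2.
rewrite (integrable_fine (integrable_fubini_G)).2.
by rewrite Fubini.
Qed.

End fubini_on_a_domain.

(** * The domain under a moving front *)

(** Continuity of [g] inside [A], tested along any filter that stays in [A] and
converges to a point of [A]; it serves both for two-sided limits in the open
domain and for one-sided limits at its boundary.  *)
Lemma cvg_within_comp {U V : topologicalType} (A : set U) (g : U -> V)
    (I : Type) (F : set_system I) (phi : I -> U) (z : U) : Filter F ->
  {within A, continuous g} -> A z -> phi x @[x --> F] --> z ->
  (\forall x \near F, A (phi x)) -> g (phi x) @[x --> F] --> g z.
Proof.
move=> FF /subspace_continuousP cg Az phiz Aphi.
apply: (@cvg_comp _ _ _ phi g _ (within A (nbhs z))); last exact: cg.
move=> B nB; have zB := phiz _ nB.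
by apply: filterS2 Aphi zB => x Ax; apply.
Qed.

Lemma closure_of_cvg {U : topologicalType} (A : set U)
    (I : Type) (F : set_system I) (phi : I -> U) (z : U) : ProperFilter F ->
  phi x @[x --> F] --> z -> (\forall x \near F, A (phi x)) -> closure A z.
Proof.
move=> FF phiz Aphi B nB; have Bphi := phiz _ nB.
by have [x [Ax Bx]] := filter_ex (filterI Aphi Bphi); exists (phi x).
Qed.

Lemma cvg_pair_at {R : realType} (I : Type) (F : set_system I) (f g : I -> R)
    (x y : R) : Filter F ->
  f i @[i --> F] --> x -> g i @[i --> F] --> y ->
  (f i, g i) @[i --> F] --> (x, y).
Proof. by move=> FF fx gy; exact: (cvg_pair fx gy). Qed.

Section moving_domain.
Context {R : realType}.
Variables (b T : R) (s : R -> R).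
Hypothesis s0 : s 0 = b.
Hypothesis s_cont : {within `[0, T], continuous s}.
Hypothesis s_mono : forall x y : R, 0 <= x -> x <= y -> y <= T -> s x <= s y.

Let s_ge_b (x : R) : 0 <= x <= T -> b <= s x.
Proof. by move=> /andP[x0 xT]; rewrite -s0; exact: s_mono. Qed.

Let s_ivt (t v : R) : 0 <= t <= T -> b <= v <= s t ->
  exists2 y, 0 <= y <= t & s y = v.
Proof.
move=> /andP[t0 tT] /andP[bv vs].
have [||y] := @IVT _ s 0 t v t0.
- apply: continuous_subspaceW s_cont => y /=; rewrite !in_itv/= => /andP[-> yt].
  exact: le_trans yt tT.
- by rewrite s0 ge_min le_max bv vs orbT.
by rewrite in_itv/=; exists y.
Qed.

Lemma measurable_Qdom (t : R) : t <= T -> measurable (Qdom s t).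
Proof.
move=> tT.
pose s1 := s \_ (`[0, T] : set R).
have ms1 : measurable_fun setT s1.
  apply/(measurable_restrictT s) => //.
  exact: subspace_continuous_measurable_fun.
pose gap (z : R * R) := s1 z.2 - z.1.
have mgap : measurable_fun setT gap.
  by apply: measurable_funB => //; exact: measurableT_comp.
rewrite (_ : Qdom s t = (`]0, +oo[ `*` `]0, t[) `&` gap @^-1` `]0, +oo[).
  apply: measurableI; first exact: measurableX.
  by rewrite -[X in measurable X]setTI; exact: mgap.
apply/seteqP; split => -[x y] /=; rewrite !in_itv/= !andbT.
- move=> [/andP[x0 xs] /andP[y0 yt]]; rewrite /= in x0 xs y0 yt.
  have yT : y \in `[0, T]%classic.
    by rewrite inE/= in_itv/= (ltW y0) (le_trans (ltW yt)).
  by rewrite x0 y0 yt /gap /s1 /= patchE yT subr_gt0.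
- move=> [[x0 /andP[y0 yt]]].
  have yT : y \in `[0, T]%classic.
    by rewrite inE/= in_itv/= (ltW y0) (le_trans (ltW yt)).
  by rewrite /gap /s1 /= patchE yT subr_gt0 => xs; rewrite /Qdom/= x0 xs y0 yt.
Qed.

Lemma ysection_Qdom (t y : R) : 0 < y < t ->
  ysection (Qdom s t) y = `]0, s y[%classic.
Proof.
move=> yt; apply/seteqP; split => x; rewrite /ysection/= inE /Qdom/= in_itv/=.
  by case.
by [].
Qed.

Lemma ysection_Qdom0 (t y : R) : ~~ (0 < y < t) -> ysection (Qdom s t) y = set0.
Proof.
move=> yt; apply/seteqP; split => x //; rewrite /ysection/= inE /Qdom/=.
by move=> [_ h]; rewrite h in yt.
Qed.

Lemma xsection_Qdom0 (t x : R) : t <= T -> ~~ (0 < x < s t) ->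
  xsection (Qdom s t) x = set0.
Proof.
move=> tT xt; apply/seteqP; split => y //; rewrite /xsection/= inE /Qdom/=.
move=> [/andP[x0 xs] /andP[y0 yt]]; move: xt; rewrite x0/= -leNgt => st.
by have := s_mono (ltW y0) (ltW yt) tT; rewrite leNgt (le_lt_trans st).
Qed.

(** Here [c] is the time at which the vertical line through [x] enters the
domain: time [0] if it lies under the initial front, and otherwise the last time
at which the front is at [x].  The line [x = b] fits neither case when it enters
at the corner [(b, 0)]; it has measure zero.  *)
Lemma xsection_Qdom (t x : R) : 0 < t <= T -> 0 < x < s t -> x != b ->
  exists2 c, 0 <= c < t &
    xsection (Qdom s t) x = `]c, t[%classic /\
    (c = 0 /\ x < b \/ 0 < c /\ s c = x /\ b < x).
Proof.
move=> /andP[t0 tT] /andP[x0 xs] xb.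
case: (ltgtP x b) xb => // xb _.
  exists 0; first by rewrite lexx.
  split; last by left.
  apply/seteqP; split => y; rewrite /xsection/= inE /Qdom/= in_itv/=.
    by case.
  move=> /andP[y0 yt]; rewrite x0 y0 yt/=; split => //.
  by rewrite (lt_le_trans xb)// s_ge_b// (ltW y0) (le_trans (ltW yt)).
pose E : set R := [set y | 0 <= y <= t /\ s y <= x].
have E0 : E 0 by rewrite /E/= lexx (ltW t0) s0 (ltW xb).
have Eub : ubound E t by move=> y [/andP[]].
have hubE : has_ubound E by exists t.
have supE : has_sup E by split; [exists 0|exists t].
pose c := sup E.
have c0 : 0 <= c by have := ub_le_sup hubE E0.
have ct : c <= t by apply: ge_sup => //; exists 0.
have after y : c < y -> y <= t -> x < s y.
  move=> cy yt; rewrite ltNge; apply/negP => sy.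
  have : y <= c.
    by apply: (ub_le_sup hubE); split=> //; rewrite yt (le_trans c0 (ltW cy)).
  by rewrite leNgt cy.
(* otherwise the front passes (x + s c) / 2 before time c, and E ends there *)
have sc_le : s c <= x.
  rewrite leNgt; apply/negP => xsc.
  have [||z zc sz] := @s_ivt c ((x + s c) / 2); [lra|lra|].
  have zltc : z < c.
    by rewrite ltNge; apply/negP => cz; have := s_mono c0 cz; rewrite sz; lra.
  have [|y [y0t sy] zy] := sup_adherent (_ : 0 < c - z) supE.
    by rewrite subr_gt0.
  have := @s_mono z y; rewrite sz -/c in zy *; lra.
have [||y0 y0t sy0] := @s_ivt t x; [lra|lra|].
have y0c : y0 <= c by apply: (ub_le_sup hubE); rewrite /E/= sy0.
have sc : s c = x.
  apply/eqP; rewrite eq_le sc_le/= -sy0; apply: s_mono => //; lra.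
have c_gt0 : 0 < c.
  rewrite lt_neqAle c0 andbT; apply/eqP => c0'.
  by move: sc; rewrite -c0' s0 => h; rewrite h ltxx in xb.
have c_lt : c < t.
  rewrite lt_neqAle ct andbT; apply/eqP => ct'.
  by move: sc; rewrite ct' => h; rewrite h ltxx in xs.
exists c; first by rewrite c0.
split; last by right.
apply/seteqP; split => y; rewrite /xsection/= inE /Qdom/= in_itv/=.
  move=> [/andP[_ xy] /andP[y0' yt]]; rewrite yt andbT ltNge; apply/negP => yc.
  by have := s_mono (ltW y0') yc; rewrite sc; lra.
move=> /andP[cy yt]; rewrite x0 yt (lt_trans c_gt0 cy)/=; split => //.
by apply: after => //; exact: ltW.
Qed.

End moving_domain.

(** * Heat content and flux of a solution *)

Section classical_solution_balance.
Context {R : realType}.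
Variables (alpha b T : R) (h u0 s : R -> R) (u : R * R -> R).
Hypothesis b_gt0 : 0 < b.
Hypothesis T_gt0 : 0 < T.
Hypothesis s0 : s 0 = b.
Hypothesis s_cont : {within `[0, T], continuous s}.
Hypothesis s_mono : forall x y : R, 0 <= x -> x <= y -> y <= T -> s x <= s y.
Hypothesis sol : classical_solution alpha b T h u0 s u.
Hypothesis ut_int : (mu \x mu)%E.-integrable (Qdom s T) (EFin \o time_deriv u).

Let s_gt0 (t : R) : 0 <= t <= T -> 0 < s t.
Proof.
move=> /andP[t0 tT]; apply: lt_le_trans b_gt0 _.
by rewrite -s0; exact: s_mono.
Qed.

(** A point of the closed slice at time [t] is reached from inside by moving
linearly towards the middle of the slice while time increases; the front does
not move back, so the path stays below it.  *)
Lemma slice_closure_Qdom (x t : R) : 0 <= t < T -> 0 <= x <= s t ->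
  closure (Qdom s T) (x, t).
Proof.
move=> /andP[t0 tT] /andP[x0 xs].
have st0 : 0 < s t by apply: s_gt0; rewrite t0 ltW.
apply: (@closure_of_cvg _ _ _ (0^'+)
  (fun e => (x + e * (s t / 2 - x), t + e)) (x, t)).
  apply: cvg_pair_at; apply: cvg_at_right_filter.
    rewrite -[X in _ --> X]addr0 -[X in _ --> _ + X](mul0r (s t / 2 - x)).
    by apply: cvgD; [exact: cvg_cst|apply: cvgMl; exact: cvg_id].
  rewrite -[X in _ --> X]addr0.
  by apply: cvgD; [exact: cvg_cst|exact: cvg_id].
near=> e; rewrite /Qdom/=.
have e0 : 0 < e by [].
have e1 : e < 1 by near: e; exact: nbhs_right_lt.
have eT : e < T - t by near: e; apply: nbhs_right_lt; rewrite subr_gt0.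
have ss : s t <= s (t + e) by apply: s_mono; lra.
have p1 : 0 <= (1 - e) * x by rewrite mulr_ge0//; lra.
have p2 : 0 <= (1 - e) * (s t - x) by rewrite mulr_ge0//; lra.
have p3 : 0 < e * s t by rewrite mulr_gt0.
by split; lra.
Unshelve. all: by end_near. Qed.

Lemma solution_cvg (z : R * R) (I : Type) (F : set_system I)
    (phi : I -> R * R) : Filter F ->
  closure (Qdom s T) z -> phi i @[i --> F] --> z ->
  (\forall i \near F, closure (Qdom s T) (phi i)) ->
  u (phi i) @[i --> F] --> u z.
Proof.
move=> FF Qz phiz Qphi.
refine (@cvg_within_comp _ _ _ _ _ _ _ _ FF _ Qz phiz Qphi).
exact: (cs_cont sol).
Qed.

(** At [t = 0] this is what makes the initial datum integrable.  *)
Lemma slice_continuous (t : R) : 0 <= t < T ->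
  {within `[0, s t], continuous (fun x => u (x, t))}.
Proof.
move=> t0T; apply/subspace_continuousP => x; rewrite /= in_itv/= => xst.
apply: (@solution_cvg (x, t) _ _ (fun x => (x, t))).
- exact: slice_closure_Qdom.
- apply: cvg_pair_at; last exact: cvg_cst.
  by apply: cvg_within.
- near=> y; apply: slice_closure_Qdom => //.
  have : y \in `[0, s t] by near: y; exact: withinT.
  by rewrite in_itv.
Unshelve. all: by end_near. Qed.

Lemma slice_integrable (t : R) : 0 <= t < T ->
  mu.-integrable `]0, s t[ (EFin \o (fun x => u (x, t))).
Proof.
move=> t0T; apply: (@lebesgue_integrableS _ `[0, s t]) => //.
  by move=> x; rewrite /= !in_itv/= => /andP[/ltW -> /ltW ->].
apply: continuous_compact_integrable; first exact: segment_compact.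
exact: slice_continuous.
Qed.

Lemma initial_datum_integrable : mu.-integrable `]0, b[ (EFin \o u0).
Proof.
have := @slice_integrable 0; rewrite s0 lexx T_gt0 => /(_ isT).
apply: eq_integrable => // x; rewrite inE/= in_itv/= => x0b.
by rewrite (cs_init sol).
Qed.

Lemma Qdom_xsection_itv (x t c d : R) :
  xsection (Qdom s t) x = `]c, d[%classic -> t <= T ->
  forall y, c < y < d -> Qdom s T (x, y).
Proof.
move=> Ecd tT y ycd.
have : xsection (Qdom s t) x y by rewrite Ecd /= in_itv.
rewrite /xsection/= inE /Qdom/= => -[xs /andP[y0 yt]].
by rewrite xs y0 (lt_le_trans yt tT).
Qed.

Lemma time_deriv_slice_cvg (z : R * R) (I : Type) (F : set_system I)
    (phi : I -> R * R) : Filter F -> Qdom s T z -> phi i @[i --> F] --> z ->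
  (\forall i \near F, Qdom s T (phi i)) ->
  time_deriv u (phi i) @[i --> F] --> time_deriv u z.
Proof.
move=> FF Qz phiz Qphi.
refine (@cvg_within_comp _ _ _ _ _ _ _ _ FF _ Qz phiz Qphi).
exact: (cs_ut_cont sol).
Qed.

(** The line enters the domain at a boundary point [(x, c)] where [u_t] may
blow up, so the increment of [u] is an improper integral; continuity of [u] on
the closure identifies its lower end.  *)
Lemma time_increment (x t c : R) : 0 < t < T -> 0 <= c < t -> 0 < x < s t ->
  xsection (Qdom s t) x = `]c, t[%classic ->
  mu.-integrable `]c, t[ (fun y => (time_deriv u (x, y))%:E) ->
  u (x, t) = u (x, c) + \int[mu]_(y in `]c, t[) time_deriv u (x, y).
Proof.
move=> /andP[t0 tT] /andP[c0 ct] xst Ect iut.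
have inQ := Qdom_xsection_itv Ect (ltW tT).
have xtQ : Qdom s T (x, t) by rewrite /Qdom/= xst t0 tT.
(* (x, c) lies in the closure, as the limit of the line from above *)
have cx : (x, y) @[y --> c^'+] --> (x, c).
  by apply: cvg_pair_at; [exact: cvg_cst|exact: cvg_at_right_filter cvg_id].
have nQ : \forall y \near c^'+, Qdom s T (x, y).
  apply: filterS2 (nbhs_right_gt c) (nbhs_right_lt ct) => y cy yt.
  by apply: inQ; rewrite cy.
apply: (@cvg_unique _ (@norm_hausdorff _ R) (u (x, y) @[y --> t^'-])).
  apply: cvg_at_left_filter.
  exact/differentiable_continuous/derivable1_diffP/(cs_ut sol).
apply: (@improper_FTC _ c t (u (x, c)) (fun y => time_deriv u (x, y))) => //.
- move=> y yct; apply: time_deriv_slice_cvg; first exact: inQ.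
    by apply: cvg_pair_at; [exact: cvg_cst|exact: cvg_id].
  near=> z; apply: inQ.
  have : z \in `]c, t[ by near: z; exact: near_in_itvoo.
  by rewrite in_itv.
- by move=> y yct; apply: (cs_ut sol); exact: inQ.
- apply: (@solution_cvg (x, c)) => //.
  + exact: closure_of_cvg cx nQ.
  + by apply: filterS nQ => y; exact: subset_closure.
Unshelve. all: by end_near. Qed.

(** [Dx alpha u] is a primitive of [u_t] on the slice, with limit [- h t] at
[x = 0].  *)
Lemma flux_at_front (t : R) : 0 < t < T ->
  mu.-integrable `]0, s t[ (fun x => (time_deriv u (x, t))%:E) ->
  - Dx alpha u x t @[x --> (s t)^'-] -->
    h t - \int[mu]_(x in `]0, s t[) time_deriv u (x, t).
Proof.
move=> t0T iut; have /andP[t0 tT] := t0T.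
rewrite -[X in _ --> X]opprK; apply: cvgN; rewrite opprB addrC.
have inQ x : 0 < x < s t -> Qdom s T (x, t) by rewrite /Qdom/= t0T.
apply: (@improper_FTC _ 0 (s t) (- h t) (fun x => time_deriv u (x, t))) => //.
- by apply: s_gt0; rewrite !ltW.
- move=> x xst; apply: time_deriv_slice_cvg; first exact: inQ.
    by apply: cvg_pair_at; [exact: cvg_id|exact: cvg_cst].
  near=> z; apply: inQ.
  have : z \in `]0, s t[ by near: z; exact: near_in_itvoo.
  by rewrite in_itv.
- by move=> x xst; apply: (cs_flux sol); exact: inQ.
- by move=> x xst; rewrite (cs_eq sol)//; exact: inQ.
- rewrite (_ : Dx alpha u ^~ t = - (fun x => - Dx alpha u x t)).
    exact: cvgN (cs_left sol t0T).
  by apply/funext => x; rewrite opprfctE opprK.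
Unshelve. all: by end_near. Qed.

Let ut_int_upto (t : R) : 0 < t < T ->
  (mu \x mu)%E.-integrable (Qdom s t) (EFin \o time_deriv u).
Proof.
move=> /andP[t0 tT].
apply: (@integrableS _ _ _ (mu \x mu)%E (Qdom s T)) ut_int.
- exact: (measurable_Qdom s_cont (lexx T)).
- exact: (measurable_Qdom s_cont (ltW tT)).
- by move=> -[x y] [/= xs /andP[y0 yt]]; split; rewrite //= y0 (lt_trans yt tT).
Qed.

(** Both sides are the integral of [u_t] over [Qdom s t], computed by vertical
lines on the left and by time slices on the right.  *)
Lemma heat_balance (t : R) : 0 < t < T ->
  \int[mu]_(x in `]0, s t[) u (x, t) - \int[mu]_(x in `]0, b[) u0 x =
  \int[mu]_(y in `]0, t[) \int[mu]_(x in `]0, s y[) time_deriv u (x, y).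
Proof.
move=> t0T; have /andP[t0 tT] := t0T.
have mQ : measurable (Qdom s t) := measurable_Qdom s_cont (ltW tT).
have iut := ut_int_upto t0T.
have iu : mu.-integrable `]0, s t[ (EFin \o (fun x => u (x, t))).
  by apply: slice_integrable; rewrite (ltW t0).
have iu0 := initial_datum_integrable.
transitivity (\int[mu]_y
    \int[mu]_(x in ysection (Qdom s t) y) time_deriv u (x, y)); last first.
  rewrite [RHS]Rintegral_mkcond; apply: eq_Rintegral => y _.
  rewrite patchE; case: ifPn => [|/negP]; rewrite inE/= in_itv/= => yt.
    by rewrite (ysection_Qdom _ yt).
  by rewrite (ysection_Qdom0 _ (introN idP yt)) Rintegral_set0.
rewrite -(Rintegral_sections mQ iut).
rewrite (Rintegral_mkcond mu `]0, s t[) (Rintegral_mkcond mu `]0, b[).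
have iu' : mu.-integrable setT (EFin \o ((fun x => u (x, t)) \_ `]0, s t[)).
  by rewrite -restrict_EFin; exact/(integrable_mkcond _ _).1.
have iu0' : mu.-integrable setT (EFin \o (u0 \_ `]0, b[)).
  by rewrite -restrict_EFin; exact/(integrable_mkcond _ _).1.
rewrite -RintegralB//; apply: ae_eq_Rintegral.
- by have := integrableB measurableT iu' iu0'.
- exact: (integrable_xsection_integral mQ iut).
have xb : {ae mu, forall x, x <> b}.
  exists [set b]; split; [exact: measurable_set1|exact: lebesgue_measure_set1|].
  by move=> x /= /contrapT.
have := ae_and xb (ae_integrable_xsection mQ iut).
apply: ae_imp => x [/eqP {}xb ix].
have bst : b <= s t by rewrite -s0; apply: s_mono => //; exact: ltW.
rewrite !patchE !mem_setE !in_itv/= (_ : point = 0 :> R)//.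
case: ifPn => xst; last first.
  rewrite (xsection_Qdom0 s_mono (ltW tT) xst) Rintegral_set0.
  case: ifPn => [/andP[x0 xlb]|_]; last by rewrite subr0.
  by move: xst; rewrite x0 (lt_le_trans xlb bst).
have tT' : 0 < t <= T by rewrite t0 ltW.
have [c c0t [Ect cE]] := xsection_Qdom s0 s_cont s_mono tT' xst xb.
rewrite Ect in ix *; rewrite (time_increment t0T c0t xst Ect ix).
have /andP[x0 _] := xst; rewrite x0/= addrAC.
(* the value of u at the point where the line enters the domain *)
suff -> : u (x, c) = (if x < b then u0 x else 0) by rewrite subrr add0r.
case: cE => [[-> xlb]|[c0 [<- xgb]]].
  by rewrite xlb (cs_init sol)// x0.
have cT : c < T by have /andP[_ ct] := c0t; exact: lt_trans tT.
by rewrite ltNge -s0 (s_mono (lexx 0) (ltW c0) (ltW cT))/= (cs_right sol)// c0.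
Qed.

Lemma ae_slice_integrable : {ae mu, forall t, 0 < t < T ->
  mu.-integrable `]0, s t[ (fun x => (time_deriv u (x, t))%:E)}.
Proof.
have := ae_integrable_ysection (measurable_Qdom s_cont (lexx T)) ut_int.
by apply: ae_imp => t + t0T; rewrite (ysection_Qdom _ t0T).
Qed.

Lemma integrable_slice_integral : mu.-integrable `]0, T[
  (EFin \o (fun t => \int[mu]_(x in `]0, s t[) time_deriv u (x, t))).
Proof.
have mQ := measurable_Qdom s_cont (lexx T).
have iW := integrable_ysection_integral mQ ut_int.
have := @lebesgue_integrableS _ setT `]0, T[ _ measurableT (measurable_itv _)
  (@subsetT _ _) iW.
apply: eq_integrable => // t; rewrite inE/= in_itv/= => t0T.
by rewrite (ysection_Qdom _ t0T).
Qed.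

End classical_solution_balance.

(** * Extending the front and identifying its velocity *)

(** The essential bound only holds almost everywhere, hence the comparison of
integrals up to a null set.  *)
Lemma Linfty_integrable {R : realType} (a c : R) (f : R -> R) : Linfty a c f ->
  mu.-integrable `]a, c[ (EFin \o f).
Proof.
rewrite /Linfty => /andP[]; rewrite !inE/= => mf ff.
pose g := f \_ `]a, c[.
have [C gC] : exists C : R, {ae mu, forall x, `|g x| <= C}.
  have mu_gt0 : (0 < (@lebesgue_measure R) setT)%E.
    apply: (@lt_le_trans _ _ ((@lebesgue_measure R) `]0, 1[)).
      by rewrite lebesgue_measure_itv/= lte01 oppr0 adde0 lte01.
    by apply: le_measure => //; rewrite inE.
  move: ff; rewrite /finite_norm unlock mu_gt0 => fin.
  have := @ess_sup_ge _ _ _ mu (abse \o (EFin \o g)).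
  move: fin; rewrite -/g; case: (ess_sup _ _) => [C _|//|_] hC.
    by exists C; move: hC; apply: ae_imp => x.
  by exists 0; move: hC; apply: ae_imp => x.
have mfI : measurable_fun `]a, c[ f by exact/(measurable_restrictT _ _).2.
apply/integrableP; split; first exact/measurable_EFinP.
have /integrableP[_] := integrable_cst_itv a c C.
apply: le_lt_trans; apply: ae_ge0_le_integral => //.
- by apply: measurableT_comp => //; exact/measurable_EFinP.
- by apply: measurableT_comp => //; exact/measurable_EFinP/measurable_cst.
- apply: ae_imp gC => x; rewrite /g patchE /= => gx xac.
  by rewrite lee_fin (le_trans _ (ler_norm C))//; move: gx; rewrite mem_set.
Qed.

(** Precomposing with [clip T] extends a function from [[0, T]] to the line with
the same Lipschitz constant, so that difference quotients make sense up to the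
endpoints.  *)
Definition clip {R : realType} (T t : R) : R := Num.max 0 (Num.min t T).

Lemma clip_id {R : realType} (T t : R) : 0 <= t <= T -> clip T t = t.
Proof. by move=> /andP[t0 tT]; rewrite /clip min_l// max_r. Qed.

Lemma clip_itv {R : realType} (T t : R) : 0 <= T -> 0 <= clip T t <= T.
Proof.
by move=> T0; rewrite /clip le_max lexx/= ge_max T0/= ge_min lexx orbT.
Qed.

Lemma clip_lipschitz {R : realType} (T x y : R) : 0 <= T ->
  `|clip T x - clip T y| <= `|x - y|.
Proof.
move=> T0.
have clipE z : [\/ clip T z = z /\ 0 <= z <= T, clip T z = 0 /\ z <= 0 |
                  clip T z = T /\ T <= z].
  rewrite /clip; have [zT|/ltW zT] := leP z T.
    have [z0|/ltW z0] := leP 0 z; [|by constructor 2].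
    by constructor 1; split=> //; rewrite zT andbT.
  by constructor 3; rewrite max_r.
have := ler_norm (y - x); rewrite distrC => yx; have xy := ler_norm (x - y).
rewrite ler_norml.
by case: (clipE x) => -[-> ?]; case: (clipE y) => -[-> ?]; lra.
Qed.

Lemma lipschitz_clip {R : realType} (T : R) (s : R -> R) : 0 <= T ->
  [lipschitz s t | t in `[0, T]%classic] ->
  exists L : R, forall x y,
    `|s (clip T x) - s (clip T y)| <= L * `|x - y|.
Proof.
move=> T0 [M [Mreal sM]].
exists (`|M| + 1) => x y.
have /= := sM (`|M| + 1) _ (clip T x, clip T y).
rewrite !in_itv/= !clip_itv// => h.
apply: le_trans (h _ _) _ => //.
  by rewrite (le_lt_trans (ler_norm M))// ltrDl.
by rewrite ler_wpM2l ?clip_lipschitz.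
Qed.

Lemma derivable_clip {R : realType} (T t : R) (s : R -> R) : 0 < t < T ->
  (derivable (s \o clip T) t 1 <-> derivable s t 1) /\
  derive1 (s \o clip T) t = derive1 s t.
Proof.
move=> /andP[t0 tT].
have E : {near t, s \o clip T =1 s}.
  near=> y; rewrite /= clip_id//.
  have : y \in `]0, T[ by near: y; apply: near_in_itvoo; rewrite in_itv/= t0.
  by rewrite in_itv/= => /andP[/ltW -> /ltW ->].
split; last by rewrite !derive1E; exact: near_eq_derive.
split; apply: near_eq_derivable => //.
by apply: filterS E => y /= ->.
Unshelve. all: by end_near. Qed.

(** From left to right this is [lipschitz_FTC]; from right to left it is
Lebesgue's differentiation theorem for the indefinite integral of [v].  *)
Lemma derive_ae_eqP {R : realType} (T L : R) (s v : R -> R) : 0 < T ->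
  (forall x y, `|s x - s y| <= L * `|x - y|) ->
  mu.-integrable `]0, T[ (EFin \o v) ->
  {ae mu, forall t, 0 < t < T ->
     derivable s t 1 /\ derive1 s t = v t} <->
  (forall t, 0 < t < T -> s t = s 0 + \int[mu]_(x in `]0, t[) v x).
Proof.
move=> T0 lip iv; split=> [sv t /andP[t0 tT]|sv].
  have sub : `]0, t[ `<=` `]0, T[.
    by move=> x; rewrite /= !in_itv/= => /andP[-> /lt_trans]; apply.
  have ivt := lebesgue_integrableS (measurable_itv _) (measurable_itv _) sub iv.
  have mv : measurable_fun `]0, t[ v.
    by apply/measurable_EFinP; case/integrableP: ivt.
  rewrite -(@lipschitz_FTC _ L 0 t s v)//; first by rewrite addrC subrK.
  apply: ae_imp sv => x + /andP[x0 xt]; apply.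
  by rewrite x0 (lt_trans xt).
have iv' : mu.-integrable setT (EFin \o (v \_ `]0, T[)).
  rewrite -restrict_EFin.
  exact: (@integrable_mkcond _ _ _ mu _ (EFin \o v) (measurable_itv _)).1.
have lv := integrable_locally_restrict (measurable_itv _) iv.
have iv'y y : mu.-integrable `[0, y] (EFin \o (v \_ `]0, T[)).
  exact: lebesgue_integrableS iv'.
have := @FTC1 R (v \_ `]0, T[) (BLeft 0) iv'y lv.
apply: ae_imp => t dF /andP[t0 tT].
have bt : (BLeft (0%R : R) < BRight t)%E by rewrite /= lte_fin.
have [dF1 dF2] := dF bt.
set F := (fun x => _) in dF1 dF2.
have sE : {near t, (cst (s 0) \+ F) =1 s}.
  near=> y.
  have : y \in `]0, T[ by near: y; apply: near_in_itvoo; rewrite in_itv/= t0.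
  rewrite in_itv/= => /andP[y0 yT]; rewrite /= (sv y) ?y0//; congr (_ + _).
  rewrite /F -Rintegral_itv_oo_cc.
    apply: eq_Rintegral => x; rewrite inE/= in_itv/= => /andP[x0 xy].
    by rewrite patchE mem_set//= in_itv/= x0 (lt_trans xy).
  exact: lebesgue_integrableS measurableT (measurable_itv _) (@subsetT _ _) iv'.
have vt : (v \_ `]0, T[) t = v t.
  by rewrite patchE mem_set//= in_itv/= t0.
have dcF : is_derive t 1 (cst (s 0) \+ F) (0 + v t).
  apply: is_deriveD; apply: (DeriveDef dF1).
  by rewrite -derive1E dF2 vt.
split; first by apply: (near_eq_derivable sE); case: dcF.
rewrite derive1E -(near_eq_derive _ sE).
by case: dcF => _ ->; rewrite add0r.
Unshelve. all: by end_near. Qed.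

(** * The Stefan condition and the integral condition *)

Theorem theorem1 (R : realType) (alpha b T M : R) (u0 h s : R -> R)
    (u : R * R -> R)
    (alpha01 : 0 < alpha < 1) (b_gt0 : 0 < b) (T_gt0 : 0 < T)
    (u0_ge0 : forall x : R, 0 < x < b -> 0 <= u0 x)
    (h_W1infty : W1infty 0 T h)
    (h_ge0 : {ae (@lebesgue_measure R), forall t : R, 0 < t < T -> 0 <= h t})
    (s_lipschitz : [lipschitz s t | t in `[0, T]%classic])
    (s0 : s 0 = b)
    (M_gt0 : 0 < M)
    (ds_bound : {ae (@lebesgue_measure R), forall t : R, 0 <= t <= T ->
       derivable s t 1 /\ 0 <= derive1 s t <= M})
    (u_sol : classical_solution alpha b T h u0 s u)
    (ut_integrable :
       (@lebesgue_measure R \x @lebesgue_measure R)%E.-integrable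
         (Qdom s T) (EFin \o time_deriv u)) :
  fractional_Stefan_condition alpha T s u <-> integral_condition b T h u0 s u.
Proof.
have [L sL] := lipschitz_clip (ltW T_gt0) s_lipschitz.
pose sc := s \o clip T.
have scE t : 0 <= t <= T -> sc t = s t by move=> t0T; rewrite /sc/= clip_id.
have s_cont : {within `[0, T], continuous s}.
  apply: (@subspace_eq_continuous _ _ _ sc); last first.
    exact/continuous_subspaceT/(lipschitz_continuous sL).
  by move=> t; rewrite inE/= in_itv/= => /scE.
have s_mono (x y : R) : 0 <= x -> x <= y -> y <= T -> s x <= s y.
  move=> x0; rewrite le_eqVlt => /predU1P[->//|xy] yT.
  rewrite -!scE ?x0 ?(le_trans (ltW xy))// ?yT ?(le_trans x0 (ltW xy))//.
  apply: (lipschitz_derive_ge0_le sL xy); apply: ae_imp ds_bound => t dst xty.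
  have t0T : 0 < t < T by lra.
  have [dE ->] := derivable_clip s t0T.
  by have [|dt /andP[]] := dst _; [lra|split=> //; exact/dE].
pose W t := \int[mu]_(x in `]0, s t[) time_deriv u (x, t).
have ih : mu.-integrable `]0, T[ (EFin \o h).
  by case: h_W1infty => /Linfty_integrable.
have iW : mu.-integrable `]0, T[ (EFin \o W).
  exact: (integrable_slice_integral s_cont ut_integrable).
have ihW : mu.-integrable `]0, T[ (EFin \o (fun t => h t - W t)).
  have : mu.-integrable `]0, T[ ((EFin \o h) \- (EFin \o W))%E.
    exact: integrableB.
  by [].
have flux : {ae mu, forall t, 0 < t < T ->
    - Dx alpha u x t @[x --> (s t)^'-] --> h t - W t}.
  apply: ae_imp (ae_slice_integrable s_cont ut_integrable) => t iut t0T.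
  exact: (flux_at_front b_gt0 s0 s_mono u_sol t0T (iut t0T)).
have stefanE : fractional_Stefan_condition alpha T s u <->
    {ae mu, forall t, 0 < t < T ->
      derivable sc t 1 /\ derive1 sc t = h t - W t}.
  split=> H; apply: ae_imp (ae_and H flux) => t [st ft] t0T.
    have [dE ->] := derivable_clip s t0T; have [ds ds'] := st t0T.
    split; first exact/dE.
    exact: (@cvg_unique _ (@norm_hausdorff _ R) _ _ _ _ ds' (ft t0T)).
  have [dE dE'] := derivable_clip s t0T; have [ds ds'] := st t0T.
  by split; [exact/dE|rewrite -dE' ds'; exact: ft].
have integralE : integral_condition b T h u0 s u <->
    (forall t, 0 < t < T -> sc t = sc 0 + \int[mu]_(x in `]0, t[) (h x - W x)).
  have key t : 0 < t < T ->
      b + \int[mu]_(tau in `]0, t[) h tau + \int[mu]_(x in `]0, b[) u0 x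
        - \int[mu]_(x in `]0, s t[) u (x, t) =
      sc 0 + \int[mu]_(x in `]0, t[) (h x - W x).
    move=> t0T; have /andP[t0 tT] := t0T.
    have sub : `]0, t[ `<=` `]0, T[.
      by move=> x; rewrite /= !in_itv/= => /andP[-> /lt_trans]; apply.
    have hb :=
      heat_balance b_gt0 T_gt0 s0 s_cont s_mono u_sol ut_integrable t0T.
    rewrite RintegralB//; last 2 first.
      exact: lebesgue_integrableS sub ih.
      exact: lebesgue_integrableS sub iW.
    rewrite (scE 0) ?lexx ?ltW// s0 -hb; lra.
  have scs t : 0 < t < T -> sc t = s t.
    by move=> /andP[t0 tT]; rewrite scE// (ltW t0) (ltW tT).
  by split=> H t t0T; have := H t t0T; rewrite (key t t0T) (scs t t0T).
rewrite stefanE integralE.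
exact: (derive_ae_eqP T_gt0 sL ihW).
Qed.
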